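(* Let $m,n\ge 1$ and let $\varphi:\mathbb{S}^m\to\mathbb{S}^n$ be a proper biharmonic quadratic form. Then, up to an isometry of $\mathbb{S}^n$ (that is, after replacing $\varphi$ by $T\circ\varphi$ for some $T\in O(n+1)$), the first $n$ components of $\varphi$ form a harmonic map $\psi:\mathbb{S}^m\to\mathbb{S}^{n-1}(1/\sqrt2)$.
   Context: $\mathbb{S}^k(r)$ denotes the $k$-dimensional Euclidean sphere of radius $r$ centered at the origin of $\mathbb{R}^{k+1}$, with its standard metric, and $\mathbb{S}^k=\mathbb{S}^k(1)$. A quadratic form $\varphi:\mathbb{S}^m\to\mathbb{S}^n$ is the restriction to $\mathbb{S}^m$ of a map $F:\mathbb{R}^{m+1}\to\mathbb{R}^{n+1}$ all of whose components are homogeneous polynomials of degree $2$ and which satisfies $|F(\overline x)|=1$ whenever $|\overline x|=1$; quadratic forms are assumed non-constant. The tension field of a smooth map $\varphi:(M,g)\to(N,h)$ is $\tau(\varphi)=\mathrm{trace}\,\nabla d\varphi$; $\varphi$ is harmonic if $\tau(\varphi)=0$. For $M$ compact, $\varphi$ is biharmonic if it is a critical point of the bienergy $E_2(\varphi)=\frac12\int_M|\tau(\varphi)|^2\,v_g$; equivalently, $\tau_2(\varphi)=-\Delta\tau(\varphi)-\mathrm{trace}\,R^N(d\varphi(\cdot),\tau(\varphi))d\varphi(\cdot)=0$, where $\Delta\sigma=-\mathrm{trace}\,\nabla^2\sigma$ and $R(X,Y)Z=\nabla_X\nabla_YZ-\nabla_Y\nabla_XZ-\nabla_{[X,Y]}Z$.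 A map is proper biharmonic if it is biharmonic but not harmonic. *)

(* Defs.v *)
From HB Require Import structures.
From mathcomp Require Import all_boot all_order all_algebra.
From mathcomp Require Import all_classical all_reals all_analysis.
Set Implicit Arguments.
Unset Strict Implicit.
Unset Printing Implicit Defensive.
Import Order.TTheory GRing.Theory Num.Theory.
Import numFieldNormedType.Exports.
Local Open Scope classical_set_scope.
Local Open Scope ring_scope.

(* The library norm on 'rV[R]_k is the sup norm, so the Euclidean structure is
   introduced here. *)
Definition dotv (R : realType) (k : nat) (u v : 'rV[R]_k) : R :=
  \sum_(i < k) u 0 i * v 0 i.

Definition enorm (R : realType) (k : nat) (u : 'rV[R]_k) : R :=
  Num.sqrt (dotv u u).

(* The index k is the dimension of the ambient space: the sphere S^d(r) is
   [sphere r : set 'rV[R]_d.+1]. *)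
Definition sphere (R : realType) (k : nat) (r : R) : set 'rV[R]_k :=
  [set x | enorm x = r].
Arguments sphere {R} k r.

(* Maps defined on a sphere are represented by functions on the ambient space;
   every notion below depends only on the values taken on the sphere. *)

(* Orthogonal projection onto the tangent space at p of the sphere centered at
   the origin that passes through p. *)
Definition projT (R : realType) (k : nat) (p v : 'rV[R]_k) : 'rV[R]_k :=
  v - (dotv v p / dotv p p) *: p.

(* For v tangent at x to the sphere through x, this is the velocity at t = 0
   of f along the curve t |-> (|x| / |x + t v|) (x + t v) of that sphere, whose
   initial velocity is v. *)
Definition sdiff (R : realType) (k l : nat) (f : 'rV[R]_k.+1 -> 'rV[R]_l)
    (x v : 'rV[R]_k.+1) : 'rV[R]_l :=
  \row_(j < l) 'D_v (fun y => f ((enorm x / enorm y) *: y) 0 j) x.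

(* Connection of the pull-back bundle f^{-1} TN, N a sphere: the Levi-Civita
   connection of N is the tangential part of the flat derivative. *)
Definition cov (R : realType) (k l : nat) (f s : 'rV[R]_k.+1 -> 'rV[R]_l)
    (x u : 'rV[R]_k.+1) : 'rV[R]_l :=
  projT (f x) (sdiff s x u).

Definition levi_civita (R : realType) (k : nat)
    (Y : 'rV[R]_k.+1 -> 'rV[R]_k.+1) (x u : 'rV[R]_k.+1) : 'rV[R]_k.+1 :=
  cov id Y x u.

(* A tangent vector field on each sphere, with value v at every x to which v is
   tangent.  It serves to evaluate tensors on vectors through their expression
   on vector fields. *)
Definition tfield (R : realType) (k : nat) (v y : 'rV[R]_k) : 'rV[R]_k :=
  projT y v.

(* (nabla d f)(X, Y) = nabla_X (df Y) - df (nabla_X Y) *)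
Definition second_fund (R : realType) (k l : nat)
    (f : 'rV[R]_k.+1 -> 'rV[R]_l) (x u v : 'rV[R]_k.+1) : 'rV[R]_l :=
  cov f (fun y => sdiff f y (tfield v y)) x u
  - sdiff f x (levi_civita (tfield v) x u).

(* (nabla^2 s)(X, Y) = nabla_X nabla_Y s - nabla_{nabla_X Y} s *)
Definition cov2 (R : realType) (k l : nat)
    (f s : 'rV[R]_k.+1 -> 'rV[R]_l) (x u v : 'rV[R]_k.+1) : 'rV[R]_l :=
  cov f (fun y => cov f s y (tfield v y)) x u
  - cov f s x (levi_civita (tfield v) x u).

Definition lie_bracket (R : realType) (k : nat)
    (X Y : 'rV[R]_k.+1 -> 'rV[R]_k.+1) (p : 'rV[R]_k.+1) : 'rV[R]_k.+1 :=
  sdiff Y p (X p) - sdiff X p (Y p).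

Definition curvature (R : realType) (k : nat)
    (p u v w : 'rV[R]_k.+1) : 'rV[R]_k.+1 :=
  let X := tfield u in let Y := tfield v in let Z := tfield w in
  levi_civita (fun q => levi_civita Z q (Y q)) p (X p)
  - levi_civita (fun q => levi_civita Z q (X q)) p (Y p)
  - levi_civita Z p (lie_bracket X Y p).

(* The rows of E form an orthonormal basis of the tangent space at x. *)
Definition tangent_frame (R : realType) (m : nat) (x : 'rV[R]_m.+1) :
    set 'M[R]_(m, m.+1) :=
  [set E | E *m E^T = 1%:M /\ forall i, dotv (row i E) x = 0].

(* The value does not depend on the frame when B is bilinear on the tangent
   space at x. *)
Definition trace_at (R : realType) (m l : nat) (x : 'rV[R]_m.+1)
    (B : 'rV[R]_m.+1 -> 'rV[R]_m.+1 -> 'rV[R]_l) : 'rV[R]_l :=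
  let E := xget 0 (tangent_frame x) in
  \sum_(i < m) B (row i E) (row i E).

Definition tension (R : realType) (m l : nat)
    (f : 'rV[R]_m.+1 -> 'rV[R]_l) (x : 'rV[R]_m.+1) : 'rV[R]_l :=
  trace_at x (second_fund f x).

(* Sign convention: Delta s = - trace nabla^2 s. *)
Definition rough_laplacian (R : realType) (m l : nat)
    (f s : 'rV[R]_m.+1 -> 'rV[R]_l) (x : 'rV[R]_m.+1) : 'rV[R]_l :=
  - trace_at x (cov2 f s x).

Definition bitension (R : realType) (m l : nat)
    (f : 'rV[R]_m.+1 -> 'rV[R]_l.+1) (x : 'rV[R]_m.+1) : 'rV[R]_l.+1 :=
  - rough_laplacian f (tension f) x
  - trace_at x (fun u v =>
      curvature (f x) (sdiff f x u) (tension f x) (sdiff f x v)).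

Fixpoint Ck (R : realType) (k d : nat) (f : 'rV[R]_k.+1 -> R) : Prop :=
  match d with
  | 0%N => continuous f
  | d'.+1 => (forall x, differentiable f x) /\ forall v, Ck d' ('D_v f)
  end.

(* A map on the sphere is smooth when it is the restriction of a smooth map of
   the ambient space. *)
Definition smooth_sphere_map (R : realType) (m l : nat) (r : R)
    (f : 'rV[R]_m.+1 -> 'rV[R]_l) : Prop :=
  (forall x, sphere m.+1 1 x -> sphere l r (f x)) /\
  exists F : 'rV[R]_m.+1 -> 'rV[R]_l,
    (forall (d : nat) (j : 'I_l), Ck d (fun x => F x 0 j)) /\
    forall x, sphere m.+1 1 x -> f x = F x.

Definition harmonic_map (R : realType) (m l : nat) (r : R)
    (f : 'rV[R]_m.+1 -> 'rV[R]_l) : Prop :=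
  smooth_sphere_map r f /\ forall x, sphere m.+1 1 x -> tension f x = 0.

Definition biharmonic_map (R : realType) (m l : nat) (r : R)
    (f : 'rV[R]_m.+1 -> 'rV[R]_l.+1) : Prop :=
  smooth_sphere_map r f /\ forall x, sphere m.+1 1 x -> bitension f x = 0.

Definition proper_biharmonic (R : realType) (m l : nat) (r : R)
    (f : 'rV[R]_m.+1 -> 'rV[R]_l.+1) : Prop :=
  biharmonic_map r f /\ ~ harmonic_map r f.

Definition quadratic_form (R : realType) (m n : nat)
    (f : 'rV[R]_m.+1 -> 'rV[R]_n.+1) : Prop :=
  [/\ exists A : 'I_n.+1 -> 'M[R]_m.+1,
        forall x, sphere m.+1 1 x -> forall j : 'I_n.+1,
          f x 0 j = \sum_(i < m.+1) \sum_(k < m.+1) A j i k * x 0 i * x 0 k,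
      forall x, sphere m.+1 1 x -> sphere n.+1 1 (f x)
    & ~ exists c, forall x, sphere m.+1 1 x -> f x = c].

Definition first_components (R : realType) (n : nat) (y : 'rV[R]_n.+1) :
    'rV[R]_n :=
  \row_(j < n) y 0 (widen_ord (leqnSn n) j).

(* Main.v *)
Require Import Defs.
From HB Require Import structures.
From mathcomp Require Import all_boot all_order all_algebra.
From mathcomp Require Import all_classical all_reals all_analysis.
From mathcomp Require Import ring lra.
Set Implicit Arguments.
Unset Strict Implicit.
Unset Printing Implicit Defensive.
Import Order.TTheory GRing.Theory Num.Theory.
Import numFieldNormedType.Exports.
Local Open Scope classical_set_scope.
Local Open Scope ring_scope.

(* Write phi_j(x) = x A_j x^T with A_j symmetric, a = (tr A_j)_j and
   rho = <a, phi>.  On the unit sphere the tension field is twice the tangential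
   part of the constant vector a.  The inner product of the biharmonic equation
   with a then reads
     4 (|x B|^2 - rho^2) = |grad rho|^2 = (m + 1 - 2 rho) (|a|^2 - rho^2),
   where rho = x B x^T with B = sum_j a_j A_j.  Homogenised in x, the only term
   of this identity that is not a multiple of |x|^2 is 2 rho^3, so |x|^2 divides
   rho: B is scalar and rho is constant.  That constant is +-|a|, which makes phi
   harmonic or constant, or (m + 1) / 2, which
   gives rho = |a| / sqrt 2.  Rotating a / |a| to the last basis vector leaves n
   components of norm 1 / sqrt 2 whose matrices are traceless, and the tension of
   such a map vanishes. *)

(** * Inner products and bilinear forms on row vectors *)

Section EuclideanAlgebra.
Variables (R : realType) (k : nat).
Implicit Types (u v w : 'rV[R]_k) (c : R).

Lemma dotvE u v : dotv u v = (u *m v^T) 0 0.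
Proof. by rewrite /dotv mxE; apply: eq_bigr => i _; rewrite mxE. Qed.

Lemma dotvC u v : dotv u v = dotv v u.
Proof. by apply: eq_bigr => i _; rewrite mulrC. Qed.

Lemma dotvDl u v w : dotv (u + v) w = dotv u w + dotv v w.
Proof. by rewrite !dotvE mulmxDl mxE. Qed.

Lemma dotvZl c u w : dotv (c *: u) w = c * dotv u w.
Proof. by rewrite !dotvE -scalemxAl mxE. Qed.

Lemma dotvNl u w : dotv (- u) w = - dotv u w.
Proof. by rewrite !dotvE mulNmx mxE. Qed.

Lemma dotvDr u v w : dotv w (u + v) = dotv w u + dotv w v.
Proof. by rewrite dotvC dotvDl !(dotvC w). Qed.

Lemma dotvZr c u w : dotv w (c *: u) = c * dotv w u.
Proof. by rewrite dotvC dotvZl (dotvC w). Qed.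

Lemma dotvNr u w : dotv w (- u) = - dotv w u.
Proof. by rewrite dotvC dotvNl (dotvC w). Qed.

Lemma dot0v w : dotv 0 w = 0.
Proof. by rewrite dotvE mul0mx mxE. Qed.

Lemma dotv0 w : dotv w 0 = 0.
Proof. by rewrite dotvC dot0v. Qed.

Lemma dotv_suml n (F : 'I_n -> 'rV[R]_k) w :
  dotv (\sum_i F i) w = \sum_i dotv (F i) w.
Proof.
by rewrite dotvE mulmx_suml summxE; apply: eq_bigr => i _; rewrite dotvE.
Qed.

Lemma dotvv_ge0 u : 0 <= dotv u u.
Proof. by apply: sumr_ge0 => i _; rewrite -expr2 sqr_ge0. Qed.

Lemma dotvv_eq0 u : (dotv u u == 0) = (u == 0).
Proof.
apply/eqP/eqP => [|->]; last exact: dot0v.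
move=> /psumr_eq0P h; apply/rowP => i; rewrite mxE.
have /eqP : u 0 i * u 0 i = 0 by apply: h => // j _; rewrite -expr2 sqr_ge0.
by rewrite mulf_eq0 orbb => /eqP.
Qed.

Lemma enorm_dotv u c : 0 <= c -> (enorm u = c) <-> (dotv u u = c ^+ 2).
Proof.
move=> c0; rewrite /enorm; split=> [<-|->]; first by rewrite sqr_sqrtr ?dotvv_ge0.
by rewrite sqrtr_sqr ger0_norm.
Qed.

Lemma enorm_eq0 u : (enorm u == 0) = (u == 0).
Proof.
by rewrite /enorm sqrtr_eq0 -dotvv_eq0 eq_le dotvv_ge0 andbT.
Qed.

Lemma sphere1P u : sphere k 1 u <-> dotv u u = 1.
Proof. by rewrite /sphere /= enorm_dotv// expr1n. Qed.

Lemma enorm_normalize u c : u != 0 -> 0 <= c -> enorm ((c / enorm u) *: u) = c.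
Proof.
move=> u0 c0; apply/enorm_dotv => //; rewrite dotvZl dotvZr.
have -> : dotv u u = enorm u ^+ 2 by apply/enorm_dotv; rewrite ?sqrtr_ge0.
have := u0; rewrite -enorm_eq0 => e0; by field.
Qed.

Definition bil (A : 'M[R]_k) u v : R := (u *m A *m v^T) 0 0.

Lemma bilE A u v : bil A u v = \sum_i \sum_j A i j * u 0 i * v 0 j.
Proof.
rewrite /bil mxE exchange_big /=; apply: eq_bigr => j _.
by rewrite !mxE mulr_suml; apply: eq_bigr => i _; rewrite (mulrC (A _ _)).
Qed.

Lemma bil_dotv A u v : bil A u v = dotv (u *m A) v.
Proof. by rewrite dotvE. Qed.

Lemma bilC A u v : A^T = A -> bil A u v = bil A v u.
Proof.
move=> AT; have -> : bil A u v = (u *m A *m v^T)^T 0 0 by rewrite [RHS]mxE.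
by rewrite !trmx_mul trmxK AT mulmxA.
Qed.

Lemma bilDl A u v w : bil A (u + v) w = bil A u w + bil A v w.
Proof. by rewrite /bil !mulmxDl mxE. Qed.
Lemma bilDr A u v w : bil A w (u + v) = bil A w u + bil A w v.
Proof. by rewrite /bil linearD /= mulmxDr mxE. Qed.
Lemma bilZl A c u w : bil A (c *: u) w = c * bil A u w.
Proof. by rewrite /bil -!scalemxAl mxE. Qed.
Lemma bilZr A c u w : bil A w (c *: u) = c * bil A w u.
Proof. by rewrite /bil linearZ /= -!scalemxAr mxE. Qed.

End EuclideanAlgebra.

(** * Differential calculus on the unit sphere *)

Section SphereDerivative.
Variables (R : realType) (k : nat).
Implicit Types (x v : 'rV[R]_k.+1).

(* [f] has derivative [d] at [x] along [v] for the radial extension used by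
   [sdiff]; only the values of [f] on the sphere through [x] matter. *)
Definition sder (g : 'rV[R]_k.+1 -> R) x v (d : R) :=
  is_derive x v (fun y => g ((enorm x / enorm y) *: y)) d.

Definition vder l (f : 'rV[R]_k.+1 -> 'rV[R]_l) x v (d : 'rV[R]_l) :=
  forall j, sder (fun y => f y 0 j) x v (d 0 j).

Lemma sdiffE l (f : 'rV[R]_k.+1 -> 'rV[R]_l) x v d :
  vder f x v d -> sdiff f x v = d.
Proof. by move=> h; apply/rowP => j; rewrite mxE; case: (h j). Qed.

Lemma unit_neq0 x : dotv x x = 1 -> x != 0.
Proof. by move=> h; rewrite -dotvv_eq0 h oner_eq0. Qed.

Lemma unit_enorm x : dotv x x = 1 -> enorm x = 1.
Proof. by move=> h; rewrite /enorm h sqrtr1. Qed.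

Lemma unit_normalize x : dotv x x = 1 -> (enorm x / enorm x) *: x = x.
Proof. by move/unit_enorm => ->; rewrite divr1 scale1r. Qed.

(** No point near [x] is zero, so the radial extension evaluates the function at unit vectors
    only. *)
Lemma sder_ext f g x v d : dotv x x = 1 ->
  (forall y, dotv y y = 1 -> f y = g y) -> sder g x v d -> sder f x v d.
Proof.
move=> hx fg; apply: near_eq_is_derive.
have x0 := unit_neq0 hx.
have : \forall y \near x, y != 0.
  exact: (@cvgr_neq0 _ _ _ (nbhs x) _ id x).
apply: filterS => y y0.
apply/esym/fg; apply/sphere1P; rewrite /sphere /= enorm_normalize//.
  exact: unit_enorm.
exact: sqrtr_ge0.
Qed.

(** Gives access to the rules of one-variable calculus, with [h] as the variable. *)
Lemma is_derive_line x v (f : 'rV[R]_k.+1 -> R) d :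
  is_derive (0 : R) (1 : R) (fun h : R => f (h *: v + x)) d -> is_derive x v f d.
Proof.
have e : (fun h : R => h^-1 *: (f (h *: v + x) - f x)) =
    (fun h => h^-1 *: (((fun h : R => f (h *: v + x)) \o shift 0) (h *: (1 : R))
                      - f (0 *: v + x))).
  by apply/funext => h /=; rewrite scale0r add0r addr0 scaler1.
case=> [h1 h2]; split; first by rewrite /derivable /= e.
by rewrite -h2 /derive /= e.
Qed.

Lemma is_derive_inv_enorm x v : dotv x x = 1 ->
  is_derive x v (fun y => (enorm y)^-1) (- dotv x v).
Proof.
move=> hx; apply: is_derive_line.
(* |x + h v|^2 is a quadratic polynomial in [h] with value 1 at h = 0. *)
have -> : (fun h : R => (enorm (h *: v + x))^-1) =
  (fun h => ((Num.sqrt \o (fun h : R => dotv v v * (h * h) + 2 * dotv x v * h + 1)) h)^-1).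
  apply/funext => h /=; rewrite /enorm; congr (Num.sqrt _)^-1.
  rewrite dotvDl !dotvDr !dotvZl !dotvZr hx (dotvC v x); ring.
have p0 : dotv v v * (0 * 0) + 2 * dotv x v * 0 + 1 = 1 :> R by ring.
have D : is_derive (0 : R) (1 : R)
    (fun h : R => dotv v v * (h * h) + 2 * dotv x v * h + 1) (2 * dotv x v).
  apply: is_derive_eq; rewrite ?scaler0 ?addr0 /GRing.scale /=; ring.
have S : is_derive (dotv v v * (0 * 0) + 2 * dotv x v * 0 + 1 : R) (1 : R)
    Num.sqrt (2^-1 : R).
  apply: is_derive_eq; first by apply: is_derive1_sqrt; rewrite p0.
  by rewrite p0 sqrtr1 mulr1.
have C := @is_derive1_comp R Num.sqrt (fun h : R => dotv v v * (h * h) + 2 * dotv x v * h + 1) 0 _ _ S D.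
have nz : (Num.sqrt \o (fun h : R => dotv v v * (h * h) + 2 * dotv x v * h + 1)) 0 != 0.
  by rewrite /= p0 sqrtr1 oner_eq0.
apply: (is_derive_eq (is_deriveV nz C)).
rewrite /= p0 sqrtr1 /GRing.scale /=; by field.
Qed.

Lemma sder_cst c x v : sder (fun=> c) x v 0.
Proof. exact: is_derive_cst. Qed.

Lemma sderD f g x v df dg :
  sder f x v df -> sder g x v dg -> sder (fun y => f y + g y) x v (df + dg).
Proof. exact: is_deriveD. Qed.

Lemma sderM f g x v df dg : dotv x x = 1 ->
  sder f x v df -> sder g x v dg ->
  sder (fun y => f y * g y) x v (df * g x + f x * dg).
Proof.
move=> hx Df Dg; apply: (is_derive_eq (is_deriveM Df Dg)).
by rewrite unit_normalize// addrC mulrC.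
Qed.

Lemma sder_sum n (f : 'I_n -> 'rV[R]_k.+1 -> R) x v (d : 'I_n -> R) :
  (forall i, sder (f i) x v (d i)) ->
  sder (fun y => \sum_i f i y) x v (\sum_i d i).
Proof.
move=> h; have := is_derive_sum h; congr is_derive.
by apply/funext => y; rewrite fct_sumE.
Qed.

Lemma is_derive_coord x v (i : 'I_k.+1) :
  is_derive x v (fun y : 'rV[R]_k.+1 => y 0 i) (v 0 i).
Proof.
apply: is_derive_line.
have -> : (fun h : R => (h *: v + x) 0 i) = (fun h => h * v 0 i + x 0 i).
  by apply/funext => h; rewrite !mxE.
apply: is_derive_eq; rewrite /GRing.scale /=; ring.
Qed.

Lemma projT_unit x v : dotv x x = 1 -> projT x v = v - dotv v x *: x.
Proof. by move=> h; rewrite /projT h divr1. Qed.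

(** The radial extension of the identity is y / |y|, and the factor 1 / |y| contributes the term
    that removes the radial part of [v]. *)
Lemma vder_id x v : dotv x x = 1 -> vder id x v (projT x v).
Proof.
move=> hx i; rewrite /sder.
have -> : (fun y : 'rV[R]_k.+1 => ((enorm x / enorm y) *: y) 0 i) =
   (fun y => (enorm y)^-1) * (fun y => y 0 i).
  by apply/funext => y; rewrite !mxE unit_enorm// div1r.
apply: (is_derive_eq (is_deriveM (is_derive_inv_enorm v hx) (is_derive_coord x v i))).
rewrite projT_unit// !mxE /GRing.scale /= unit_enorm// (dotvC v) invr1; ring.
Qed.

Section VectorRules.
Variable l : nat.
Implicit Types f g : 'rV[R]_k.+1 -> 'rV[R]_l.

Lemma vder_ext f g x v d : dotv x x = 1 ->
  (forall y, dotv y y = 1 -> f y = g y) -> vder g x v d -> vder f x v d.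
Proof.
by move=> hx fg h j; apply: (sder_ext hx) (h j) => y hy; rewrite fg.
Qed.

Lemma vder_cst (c : 'rV[R]_l) x v : vder (fun=> c) x v 0.
Proof. by move=> j; rewrite mxE; exact: sder_cst. Qed.

Lemma vderD f g x v df dg :
  vder f x v df -> vder g x v dg -> vder (fun y => f y + g y) x v (df + dg).
Proof.
move=> hf hg j; rewrite mxE; have := sderD (hf j) (hg j); congr is_derive.
by apply/funext => y; rewrite mxE.
Qed.

Lemma vderZ (f : 'rV[R]_k.+1 -> R) g x v df dg : dotv x x = 1 ->
  sder f x v df -> vder g x v dg ->
  vder (fun y => f y *: g y) x v (df *: g x + f x *: dg).
Proof.
move=> hx hf hg j; rewrite !mxE; have := sderM hx hf (hg j); congr is_derive.
by apply/funext => y; rewrite !mxE.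
Qed.

Lemma vderZl c g x v dg : dotv x x = 1 ->
  vder g x v dg -> vder (fun y => c *: g y) x v (c *: dg).
Proof.
by move=> hx hg; have := vderZ hx (sder_cst c x v) hg; rewrite scale0r add0r.
Qed.

Lemma sder_dotv f g x v df dg : dotv x x = 1 ->
  vder f x v df -> vder g x v dg ->
  sder (fun y => dotv (f y) (g y)) x v (dotv df (g x) + dotv (f x) dg).
Proof.
move=> hx hf hg; rewrite /dotv -big_split /=.
by apply: sder_sum => i; exact: sderM.
Qed.
End VectorRules.

Lemma vder_mulmx l (f : 'rV[R]_k.+1 -> 'rV[R]_l) p (M : 'M[R]_(l, p)) x v df :
  dotv x x = 1 -> vder f x v df -> vder (fun y => f y *m M) x v (df *m M).
Proof.
move=> hx hf j; rewrite !mxE.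
have h : sder (fun y => \sum_i f y 0 i * M i j) x v (\sum_i df 0 i * M i j).
  apply: sder_sum => i; have := sderM hx (hf i) (sder_cst (M i j) x v).
  by rewrite mulr0 addr0.
by move: h; congr is_derive; apply/funext => y; rewrite mxE.
Qed.

End SphereDerivative.

(** * Orthonormal bases and traces over tangent spaces *)

Lemma orthogonal_completion (R : realType) k (b : 'rV[R]_k.+1) :
  dotv b b = 1 ->
  exists T : 'M[R]_k.+1, T *m T^T = 1%:M /\ row ord_max T = b.
Proof.
move=> hb; pose e : 'rV[R]_k.+1 := delta_mx 0 ord_max.
have he : dotv e e = 1.
  by rewrite dotvE trmx_delta mul_delta_mx mxE !eqxx.
have [be|be] := eqVneq b e.
  exists 1%:M; rewrite trmx1 mulmx1; split=> //.
  by rewrite be; apply/rowP => j; rewrite !mxE eq_sym eqxx.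
(* The Householder reflection in the hyperplane orthogonal to b - e exchanges [b] and [e]. It needs
   c != 0, hence the separate case b = e. *)
pose w := b - e; pose c := dotv w w.
have c0 : c != 0 by rewrite dotvv_eq0 subr_eq0.
have ew : dotv e w = - c / 2.
  rewrite /c /w dotvDr dotvNr he dotvDl !dotvDr !dotvNr !dotvNl hb he opprK (dotvC b e).
  by field.
pose P := w^T *m w.
have PP : P *m P = c *: P.
  rewrite /P mulmxA -(mulmxA w^T) [w *m w^T]mx11_scalar -dotvE -/c.
  by rewrite -mulmxA mul_scalar_mx -scalemxAr.
have PT : P^T = P by rewrite /P trmx_mul trmxK.
exists (1%:M - (2 / c) *: P); split.
  have -> : (1%:M - (2 / c) *: P)^T = 1%:M - (2 / c) *: P.
    by apply/matrixP => i j; rewrite -{2}PT !mxE eq_sym.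
  rewrite mulmxBl !mulmxBr !mul1mx !mulmx1.
  rewrite -scalemxAr -scalemxAl PP !scalerA.
  have -> : 2 / c * (2 / c) * c = 2 / c + 2 / c by field.
  by rewrite scalerDl opprB addrK subrK.
rewrite rowE -/e mulmxBr mulmx1 -scalemxAr mulmxA.
rewrite [e *m w^T]mx11_scalar -dotvE ew mul_scalar_mx scalerA.
have -> : 2 / c * (- c / 2) = -1 by field.
by rewrite scaleN1r opprK /w addrC subrK.
Qed.

Section Frame.
Variables (R : realType) (m : nat).
Implicit Types (x u v : 'rV[R]_m.+1).

Lemma dotv_row p (M : 'M[R]_(p, m.+1)) i j :
  dotv (row i M) (row j M) = (M *m M^T) i j.
Proof. by rewrite mxE; apply: eq_bigr => t _; rewrite !mxE. Qed.

(** Complete [x] to an orthogonal matrix with last row [x] and keep the other rows. Existence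
    guarantees that [xget] in [trace_at] picks a true frame and not the default 0. *)
Lemma tangent_frame_exists x : dotv x x = 1 -> exists E, tangent_frame x E.
Proof.
move=> /orthogonal_completion[T [TT Tx]].
pose s (i : 'I_m) := widen_ord (leqnSn m) i.
exists (rowsub s T); split.
  apply/matrixP => i j; rewrite -dotv_row !row_rowsub dotv_row TT !mxE.
  by rewrite -val_eqE.
move=> i; rewrite row_rowsub -Tx dotv_row TT mxE -val_eqE /=.
by rewrite ltn_eqF.
Qed.

(** The very frame chosen inside [trace_at], so that traces become sums over its rows. *)
Definition frame x : 'M[R]_(m, m.+1) := xget 0 (tangent_frame x).

Section At.
Variable x : 'rV[R]_m.+1.
Hypothesis hx : dotv x x = 1.
Let e (i : 'I_m) := row i (frame x).

Lemma frameP : tangent_frame x (frame x).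
Proof.
by have [E hE] := tangent_frame_exists hx; apply: (xgetPex 0); exists E.
Qed.

Lemma frame_unit i : dotv (e i) (e i) = 1.
Proof. by rewrite dotv_row (proj1 frameP) mxE eqxx. Qed.

Lemma frame_tangent i : dotv (e i) x = 0.
Proof. exact: (proj2 frameP). Qed.

(** Stacking [x] on the frame gives a square matrix with orthonormal rows; its columns are then
    orthonormal too. *)
Lemma frame_resolution : (frame x)^T *m frame x + x^T *m x = 1%:M.
Proof.
have [EE Ex] := frameP.
have Ex0 : frame x *m x^T = 0.
  apply/matrixP => i j; rewrite ord1 [RHS]mxE -[RHS](Ex i).
  by rewrite !mxE; apply: eq_bigr => t _; rewrite !mxE.
have xE0 : x *m (frame x)^T = 0 by rewrite -{1}[x]trmxK -trmx_mul Ex0 trmx0.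
have MM : col_mx x (frame x) *m row_mx x^T (frame x)^T = 1%:M.
  rewrite mul_col_row Ex0 xE0 EE [x *m _]mx11_scalar -dotvE hx.
  by rewrite -scalar_mx_block.
have : row_mx x^T (frame x)^T *m col_mx x (frame x) = 1%:M :=
  @mulmx1C R m.+1 _ _ MM.
by rewrite mul_row_col addrC.
Qed.

Lemma frame_expand u : \sum_i dotv u (e i) *: e i = u - dotv u x *: x.
Proof.
have : u *m ((frame x)^T *m frame x + x^T *m x) = u.
  by rewrite frame_resolution mulmx1.
rewrite mulmxDr !mulmxA [u *m x^T]mx11_scalar -dotvE mul_scalar_mx => {2}<-.
rewrite addrK mulmx_sum_row; apply: eq_bigr => i _; congr (_ *: _).
by rewrite !mxE; apply: eq_bigr => t _; rewrite !mxE.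
Qed.

Lemma frame_parseval u v :
  \sum_i dotv u (e i) * dotv v (e i) = dotv u v - dotv u x * dotv v x.
Proof.
rewrite -(dotvC x v) -dotvZl -dotvNl -dotvDl -frame_expand dotv_suml.
by apply: eq_bigr => i _; rewrite dotvZl (dotvC v).
Qed.

(** Insert the resolution of the identity into \tr A and use the cyclicity of the trace. *)
Lemma frame_trace (A : 'M[R]_m.+1) : \sum_i bil A (e i) (e i) = \tr A - bil A x x.
Proof.
have -> : \tr A = \tr (A *m ((frame x)^T *m frame x + x^T *m x)).
  by rewrite frame_resolution mulmx1.
rewrite mulmxDr linearD /= !mulmxA (mxtrace_mulC _ (frame x)) (mxtrace_mulC _ x).
rewrite !mulmxA [x *m A *m x^T]mx11_scalar mxtrace_scalar mulr1n addrK.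
apply: eq_bigr => i _; rewrite /bil /e -row_mul.
by rewrite [in RHS]mxE [in LHS]mxE; apply: eq_bigr => t _; rewrite !mxE.
Qed.

End At.
End Frame.

(** * Tangential projection, Levi-Civita connection and curvature of the unit sphere *)

Section TangentProjection.
Variables (R : realType) (k : nat).
Implicit Types (p u v : 'rV[R]_k) (c : R).

Lemma projTD p u v : projT p (u + v) = projT p u + projT p v.
Proof. by rewrite /projT dotvDl mulrDl scalerDl opprD addrACA. Qed.

Lemma projTZ p c u : projT p (c *: u) = c *: projT p u.
Proof. by rewrite /projT dotvZl scalerBr scalerA mulrA. Qed.

Lemma projT0 p : projT p 0 = 0.
Proof. by rewrite /projT dot0v mul0r scale0r subr0. Qed.

Lemma projT_sum n p (F : 'I_n -> 'rV[R]_k) :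
  projT p (\sum_i F i) = \sum_i projT p (F i).
Proof. exact: (big_morph _ (projTD p) (projT0 p)). Qed.

Lemma projT_self p : projT p p = 0.
Proof.
rewrite /projT; have [->|p0] := eqVneq p 0; first by rewrite scaler0 subr0.
by rewrite divff ?dotvv_eq0// scale1r subrr.
Qed.

Lemma projT_tangent p u : dotv u p = 0 -> projT p u = u.
Proof. by move=> h; rewrite /projT h mul0r scale0r subr0. Qed.

Lemma dotv_projT p u : dotv (projT p u) p = 0.
Proof.
rewrite /projT; have [->|p0] := eqVneq p 0; first by rewrite dotv0.
by rewrite dotvDl dotvNl dotvZl divfK ?dotvv_eq0// subrr.
Qed.

Lemma projTK p u : projT p (projT p u) = projT p u.
Proof. by rewrite projT_tangent// dotv_projT. Qed.

End TangentProjection.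

Section SphereCurvature.
Variables (R : realType) (k : nat).
Implicit Types (p q u v w : 'rV[R]_k.+1).

Lemma vder_tfield p v u : dotv p p = 1 ->
  vder (tfield v) p u
    (- (dotv v (projT p u) *: p + dotv v p *: projT p u)).
Proof.
move=> hp; apply: (@vder_ext _ _ _ _ (fun q => v + (-1) *: (dotv v q *: q))) => //.
  by move=> q hq; rewrite /tfield projT_unit// scaleN1r.
have h := sder_dotv hp (vder_cst v p u) (vder_id u hp).
have := vderD (vder_cst v p u) (vderZl (-1) hp (vderZ hp h (vder_id u hp))).
by rewrite add0r scaleN1r dot0v add0r.
Qed.

(** When [v] is tangent at [p] the right-hand side is 0: [tfield v] is parallel at [p], which
    removes the correction terms in [second_fund], [cov2] and [curvature]. *)
Lemma levi_civita_tfield p v u : dotv p p = 1 ->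
  levi_civita (tfield v) p u = - dotv v p *: projT p u.
Proof.
move=> hp; rewrite /levi_civita /cov (sdiffE (vder_tfield v u hp)) -scaleN1r.
by rewrite projTZ projTD !projTZ projT_self projTK scaler0 add0r scaleN1r scaleNr.
Qed.

Lemma curvature_sphere p u v w : dotv p p = 1 ->
  dotv u p = 0 -> dotv v p = 0 -> dotv w p = 0 ->
  curvature p u v w = dotv w v *: u - dotv w u *: v.
Proof.
move=> hp hu hv hw.
(* On the sphere the inner derivative at q is - <w, q> [tfield b q]. As <w, p> = 0, differentiating
   at [p] along [a] only affects the coefficient <w, q>. *)
have nabla2 a b : dotv a p = 0 -> dotv b p = 0 ->
    levi_civita (fun q => levi_civita (tfield w) q (tfield b q)) p (tfield a p)
    = - dotv w a *: b.
  move=> ha hb; rewrite /levi_civita {1}/cov.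
  have -> : tfield a p = a by rewrite /tfield projT_tangent.
  rewrite (@sdiffE _ _ _ _ _ _ (- dotv w a *: b)) ?projTZ ?projT_tangent//.
  apply: (@vder_ext _ _ _ _ (fun q => dotv w q *: ((-1) *: tfield b q))) => //.
    move=> q hq; rewrite -/(levi_civita _ _ _) levi_civita_tfield// projTK.
    by rewrite scaleN1r scalerN scaleNr.
  have h := sder_dotv hp (vder_cst w p a) (vder_id a hp).
  have := vderZ hp h (vderZl (-1) hp (vder_tfield b a hp)).
  by rewrite dot0v add0r hw scale0r addr0 /tfield !projT_tangent// scaleN1r scalerN scaleNr.
have sub3 (a b c a' b' c' : 'rV[R]_k.+1) :
  a = a' -> b = b' -> c = c' -> a - b - c = a' - b' - c' by move=> -> -> ->.
apply: (etrans (sub3 _ _ _ _ _ _ (nabla2 u v hu hv) (nabla2 v u hv hu)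
  (levi_civita_tfield w (lie_bracket (tfield u) (tfield v) p) hp))).
by rewrite hw oppr0 scale0r subr0 !scaleNr opprK addrC.
Qed.

End SphereCurvature.

(** * Differential and tension field of a quadratic map *)

Section QuadraticMaps.
Variables (R : realType) (m l : nat).
Implicit Types (x y u v w : 'rV[R]_m.+1).

Definition qmap (A : 'I_l -> 'M[R]_m.+1) x y : 'rV[R]_l := \row_j bil (A j) x y.

Definition trace_vec (A : 'I_l -> 'M[R]_m.+1) : 'rV[R]_l := \row_j \tr (A j).

Lemma qmapDl A x y w : qmap A (x + y) w = qmap A x w + qmap A y w.
Proof. by apply/rowP => j; rewrite !mxE bilDl. Qed.

Lemma qmapDr A x y w : qmap A w (x + y) = qmap A w x + qmap A w y.
Proof. by apply/rowP => j; rewrite !mxE bilDr. Qed.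

Lemma qmapZl A c x w : qmap A (c *: x) w = c *: qmap A x w.
Proof. by apply/rowP => j; rewrite !mxE bilZl. Qed.

Lemma qmapZr A c x w : qmap A w (c *: x) = c *: qmap A w x.
Proof. by apply/rowP => j; rewrite !mxE bilZr. Qed.

Lemma qmap0r A w : qmap A w 0 = 0.
Proof. by apply/rowP => j; rewrite !mxE bil_dotv dotv0. Qed.

Lemma qmapC A x y : (forall j, (A j)^T = A j) -> qmap A x y = qmap A y x.
Proof. by move=> sA; apply/rowP => j; rewrite !mxE bilC. Qed.

Definition lincomb (c : 'rV[R]_l) A : 'M[R]_m.+1 := \sum_j c 0 j *: A j.

Lemma lincomb_sym c A : (forall j, (A j)^T = A j) -> (lincomb c A)^T = lincomb c A.
Proof.
move=> sA; rewrite /lincomb linear_sum /=; apply: eq_bigr => j _.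
by apply/matrixP => s t; rewrite -[in RHS]sA !mxE.
Qed.

Lemma lincomb_trace c A : \tr (lincomb c A) = dotv c (trace_vec A).
Proof.
by rewrite /lincomb raddf_sum /=; apply: eq_bigr => j _; rewrite mxtraceZ [trace_vec A 0 j]mxE.
Qed.

Lemma bil_lincomb c A x y : bil (lincomb c A) x y = dotv c (qmap A x y).
Proof.
rewrite /bil /lincomb mulmx_sumr mulmx_suml summxE; apply: eq_bigr => j _.
by rewrite -scalemxAr -scalemxAl [in LHS]mxE [qmap A x y 0 j]mxE.
Qed.

Lemma vder_qmap A f g x v df dg : dotv x x = 1 ->
  vder f x v df -> vder g x v dg ->
  vder (fun y => qmap A (f y) (g y)) x v (qmap A df (g x) + qmap A (f x) dg).
Proof.
move=> hx hf hg j; rewrite !mxE !bil_dotv.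
have := sder_dotv hx (vder_mulmx (A j) hx hf) hg; congr is_derive.
by apply/funext => y; rewrite mxE bil_dotv.
Qed.

Section Tension.
Variables (A : 'I_l -> 'M[R]_m.+1) (f : 'rV[R]_m.+1 -> 'rV[R]_l).
Hypothesis sA : forall j, (A j)^T = A j.
Hypothesis fE : forall y, dotv y y = 1 -> f y = qmap A y y.

Lemma vder_quad x w : dotv x x = 1 -> vder f x w (2 *: qmap A x (projT x w)).
Proof.
move=> hx; apply: (vder_ext hx fE).
have := vder_qmap A hx (vder_id w hx) (vder_id w hx).
by rewrite (qmapC (projT x w) x sA) -mulr2n scaler_nat.
Qed.

Lemma sdiff_quad x w : dotv x x = 1 ->
  sdiff f x w = 2 *: qmap A x (projT x w).
Proof. by move=> hx; apply/sdiffE/vder_quad. Qed.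

(** Since [tfield u y] is u - <u, y> y, the differentiated field is 2 [qmap A y u] - 2 <u, y> f(y).
    At [x] the factor <u, y> vanishes and has derivative |u|^2 = 1. *)
Lemma vder_sdiff_quad x u : dotv x x = 1 -> dotv u x = 0 -> dotv u u = 1 ->
  vder (fun y => sdiff f y (tfield u y)) x u (2 *: qmap A u u - 2 *: f x).
Proof.
move=> hx ux uu.
apply: (@vder_ext _ _ _ _
    (fun y => 2 *: qmap A y u + (-2) *: (dotv u y *: f y))) => //.
  move=> y hy; rewrite sdiff_quad// projTK projT_unit//.
  rewrite qmapDr scalerDr -scaleNr qmapZr fE// !scalerA; congr (_ + _ *: _); ring.
have h := sder_dotv hx (vder_cst u x u) (vder_id u hx).
have h1 := vderZ hx h (vder_quad u hx).
have h2 := vder_qmap A hx (vder_id u hx) (vder_cst u x u).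
have := vderD (vderZl 2 hx h2) (vderZl (-2) hx h1).
rewrite dot0v add0r ux scale0r addr0 projT_tangent// uu scale1r scaleNr.
by rewrite qmap0r addr0.
Qed.

Lemma second_fund_quad x u : dotv x x = 1 -> dotv u x = 0 -> dotv u u = 1 ->
  second_fund f x u u = projT (f x) (2 *: qmap A u u - 2 *: f x).
Proof.
move=> hx ux uu; rewrite /second_fund /cov (sdiffE (vder_sdiff_quad hx ux uu)).
rewrite levi_civita_tfield// ux oppr0 scale0r sdiff_quad// projT0.
by rewrite qmap0r scaler0 subr0.
Qed.

Lemma frame_trace_qmap x : dotv x x = 1 ->
  \sum_i qmap A (row i (frame x)) (row i (frame x)) = trace_vec A - qmap A x x.
Proof.
move=> hx; apply/rowP => j; rewrite summxE !mxE -(frame_trace hx).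
by apply: eq_bigr => i _; rewrite mxE.
Qed.

(** Summing over the frame, every multiple of f(x) is normal and is killed by the projection. The
    radius of the target sphere is left free, so that the formula covers both the given map and its
    first [n] components after rotation. *)
Lemma tension_quad x : dotv x x = 1 -> tension f x = projT (f x) (2 *: trace_vec A).
Proof.
move=> hx; rewrite /tension /trace_at -/(frame x).
under eq_bigr => i _.
  rewrite second_fund_quad ?frame_tangent ?frame_unit//.
  rewrite -scaleNr projTD !projTZ projT_self scaler0 addr0 -projTZ; over.
rewrite -projT_sum -scaler_sumr frame_trace_qmap// -fE//.
by rewrite scalerDr -scaleN1r scalerA projTD !projTZ projT_self scaler0 addr0.
Qed.

End Tension.
End QuadraticMaps.

(** * The component of the bitension field along the trace vector *)

Section Bitension.
Variables (R : realType) (m n : nat).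
Variables (A : 'I_n.+1 -> 'M[R]_m.+1) (f : 'rV[R]_m.+1 -> 'rV[R]_n.+1).
Hypothesis sA : forall j, (A j)^T = A j.
Hypothesis fE : forall y, dotv y y = 1 -> f y = qmap A y y.
Hypothesis f1 : forall y, dotv y y = 1 -> dotv (f y) (f y) = 1.
Implicit Types (x y u w : 'rV[R]_m.+1).

Let a := trace_vec A.

(** Differentiate |f|^2 = 1 along [w]. *)
Lemma dotv_sdiff_quad x w : dotv x x = 1 -> dotv (qmap A x (projT x w)) (f x) = 0.
Proof.
move=> hx; have h := vder_quad sA fE w hx.
have h1 : sder (fun y => dotv (f y) (f y)) x w 0.
  exact: (sder_ext hx (fun y hy => f1 hy) (sder_cst 1 x w)).
have [_ e1] := h1; have [_ e2] := sder_dotv hx h h.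
move: e2; rewrite e1 (dotvC (f x)) dotvZl => /esym; lra.
Qed.

Lemma vder_tension x w (df : 'rV[R]_n.+1) : dotv x x = 1 -> vder f x w df ->
  vder (tension f) x w
    ((-2) *: (dotv a df *: f x + dotv a (f x) *: df)).
Proof.
move=> hx h.
apply: (@vder_ext _ _ _ _
    (fun y => 2 *: a + (-2) *: (dotv a (f y) *: f y))) => //.
  move=> y hy; rewrite (tension_quad sA fE)// projT_unit ?f1// dotvZl.
  by rewrite !scalerA mulNr scaleNr.
have h1 := sder_dotv hx (vder_cst a x w) h.
have := vderD (vder_cst (2 *: a) x w) (vderZl (-2) hx (vderZ hx h1 h)).
by rewrite add0r dot0v add0r.
Qed.

(** On the sphere the tension is 2 (a - rho f) with rho = <a, f>. Its derivative is -2 (d rho f +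
    rho df), whose first term is normal. *)
Lemma cov_tension x w : dotv x x = 1 ->
  cov f (tension f) x w = (-2 * dotv a (f x)) *: (2 *: qmap A x (projT x w)).
Proof.
move=> hx; rewrite /cov (sdiffE (vder_tension hx (vder_quad sA fE w hx))).
rewrite !projTZ projTD !projTZ projT_self scaler0 add0r projT_tangent.
  by rewrite !scalerA.
exact: dotv_sdiff_quad.
Qed.

(** The Leibniz rule applied to -2 rho df, the covariant derivative of the tension. *)
Lemma cov2_tension x u : dotv x x = 1 -> dotv u x = 0 -> dotv u u = 1 ->
  cov2 f (tension f) x u u =
  (-2) *: (dotv a (2 *: qmap A x u) *: (2 *: qmap A x u)
           + dotv a (f x) *: second_fund f x u u).
Proof.
move=> hx ux uu; rewrite /cov2 levi_civita_tfield// ux oppr0 scale0r.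
rewrite (cov_tension _ hx) projT0 qmap0r !scaler0 subr0.
have hD := vder_sdiff_quad sA fE hx ux uu.
have hf := vder_quad sA fE u hx; rewrite projT_tangent// in hf.
have hr := sder_dotv hx (vder_cst a x u) hf.
have e : sdiff f x (tfield u x) = 2 *: qmap A x u.
  by rewrite (sdiff_quad sA fE)// projTK projT_tangent.
rewrite {1}/cov (@sdiffE _ _ _ _ _ _ ((-2) *: (dotv a (2 *: qmap A x u) *: (2 *: qmap A x u)
   + dotv a (f x) *: (2 *: qmap A u u - 2 *: f x)))).
  rewrite (second_fund_quad sA fE hx ux uu) projTZ projTD 2!(projTZ _ (dotv a _)).
  congr (_ *: (_ *: _ + _)); rewrite projTZ projT_tangent//.
  by rewrite -{1}(projT_tangent ux); exact: dotv_sdiff_quad.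
apply: (@vder_ext _ _ _ _
   (fun y => (-2) *: (dotv a (f y) *: sdiff f y (tfield u y)))) => //.
  move=> y hy; rewrite cov_tension// (sdiff_quad sA fE)// !scalerA.
  by congr (_ *: _); ring.
have := vderZl (-2) hx (vderZ hx hr hD).
by rewrite dot0v add0r e.
Qed.

(** With t the tension, the curvature of the unit sphere contributes the terms <D_i, t> D_i -
    |D_i|^2 t. Pairing with [a] uses <D_i, t> = 2 <a, D_i>, as D_i is orthogonal to f(x), and <a, t>
    = 2 (|a|^2 - rho^2). *)
Lemma dotv_bitension x : dotv x x = 1 ->
  let D i := 2 *: qmap A x (row i (frame x)) in
  let rho := dotv a (f x) in
  dotv a (bitension f x) =
  - 4 * \sum_i dotv a (D i) ^+ 2
  + (\sum_i dotv (D i) (D i) - 2 * rho) * (2 * (dotv a a - rho ^+ 2)).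
Proof.
move=> hx D rho; pose t := tension f x.
have tE : t = 2 *: (a - rho *: f x).
  by rewrite /t (tension_quad sA fE)// projTZ projT_unit// f1.
have tf : dotv t (f x) = 0.
  by rewrite tE dotvZl dotvDl dotvNl dotvZl f1// mulr1 subrr mulr0.
have at_ : dotv a t = 2 * (dotv a a - rho ^+ 2).
  by rewrite tE dotvZr dotvDr dotvNr dotvZr expr2.
have ex i : dotv (row i (frame x)) x = 0 by exact: frame_tangent.
have eD i : sdiff f x (row i (frame x)) = D i.
  by rewrite (sdiff_quad sA fE)// projT_tangent.
have Df i : dotv (D i) (f x) = 0.
  by rewrite /D dotvZl -(projT_tangent (ex i)) dotv_sdiff_quad// mulr0.
have C2 : trace_at x (cov2 f (tension f) x) =
    (-2) *: (\sum_i dotv a (D i) *: D i + rho *: t).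
  rewrite /t {2}/tension /trace_at -/(frame x) scaler_sumr -big_split scaler_sumr.
  by apply: eq_bigr => i _; rewrite cov2_tension// frame_unit.
have Cu : trace_at x (fun u v =>
      curvature (f x) (sdiff f x u) (tension f x) (sdiff f x v)) =
    \sum_i (dotv (D i) t *: D i - dotv (D i) (D i) *: t).
  rewrite /trace_at -/(frame x); apply: eq_bigr => i _.
  by rewrite eD curvature_sphere ?f1.
have Dt i : dotv (D i) t = 2 * dotv a (D i).
  by rewrite tE dotvZr dotvDr dotvNr dotvZr Df mulr0 subr0 (dotvC a).
have -> : bitension f x = (-2) *: (\sum_i dotv a (D i) *: D i + rho *: t)
    - \sum_i (dotv (D i) t *: D i - dotv (D i) (D i) *: t).
  by rewrite -C2 -Cu /bitension /rough_laplacian opprK.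
clearbody D.
have S1 : dotv a (\sum_i dotv a (D i) *: D i) = \sum_i dotv a (D i) ^+ 2.
  by rewrite dotvC dotv_suml; apply: eq_bigr => i _; rewrite dotvZl (dotvC _ a).
have S2 : dotv a (\sum_i (dotv (D i) t *: D i - dotv (D i) (D i) *: t)) =
    2 * (\sum_i dotv a (D i) ^+ 2) - (\sum_i dotv (D i) (D i)) * dotv a t.
  rewrite dotvC dotv_suml mulr_sumr mulr_suml -sumrB; apply: eq_bigr => i _.
  rewrite Dt dotvDl dotvNl !dotvZl (dotvC _ a) (dotvC t) -mulrA expr2; ring.
by rewrite dotvDr dotvNr S2 dotvZr dotvDr S1 dotvZr at_; ring.
Qed.

End Bitension.

(** * The scalar equation satisfied by rho on the unit sphere *)

Section ScalarEquation.
Variables (R : realType) (m n : nat).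
Variables (A : 'I_n.+1 -> 'M[R]_m.+1) (f : 'rV[R]_m.+1 -> 'rV[R]_n.+1).
Hypothesis sA : forall j, (A j)^T = A j.
Hypothesis fE : forall y, dotv y y = 1 -> f y = qmap A y y.
Hypothesis f1 : forall y, dotv y y = 1 -> dotv (f y) (f y) = 1.
Implicit Types (x y u : 'rV[R]_m.+1).

Let a := trace_vec A.
Let B := lincomb a A.

Lemma unit_scale x : x != 0 ->
  exists2 s, s != 0 & exists2 y, dotv y y = 1 & x = s *: y.
Proof.
move=> x0; have e0 : enorm x != 0 by rewrite enorm_eq0.
exists (enorm x) => //; exists ((1 / enorm x) *: x).
  by apply/sphere1P; exact: enorm_normalize.
by rewrite scalerA mulrCA divff// mulr1 scale1r.
Qed.

(** Both sides are homogeneous of degree 4 and agree on the unit sphere. *)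
Lemma qmap_norm x : dotv (qmap A x x) (qmap A x x) = dotv x x ^+ 2.
Proof.
have [->|/unit_scale[s s0 [y hy ->]]] := eqVneq x 0.
  by rewrite qmap0r !dot0v expr0n.
rewrite qmapZl qmapZr !dotvZl !dotvZr -fE// f1// hy; ring.
Qed.

(** Add the norm identities at x + u and x - u, where |x + u|^4 = |x - u|^4 = 4; the terms odd in
    [u] cancel. *)
Lemma qmap_polar x u : dotv x x = 1 -> dotv u x = 0 -> dotv u u = 1 ->
  4 * dotv (qmap A x u) (qmap A x u) + 2 * dotv (qmap A x x) (qmap A u u) = 2.
Proof.
move=> hx ux uu.
have := qmap_norm (x + u); have := qmap_norm (x + (-1) *: u).
have := qmap_norm x; have := qmap_norm u.
rewrite !(qmapDl, qmapDr, qmapZl, qmapZr) (qmapC u x sA).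
rewrite !(dotvDl, dotvDr, dotvZl, dotvZr) hx uu (dotvC x u) ux.
rewrite (dotvC (qmap A x u) (qmap A x x)) (dotvC (qmap A u u) (qmap A x x)).
rewrite (dotvC (qmap A u u) (qmap A x u)).
move=> h1 h2 h3 h4; lra.
Qed.

(** Sum [qmap_polar] over the frame. The trace of [qmap A] over the tangent space is a - f(x), and
    its part - f(x) turns the dimension m into m + 1. *)
Lemma energy_density x : dotv x x = 1 ->
  \sum_i dotv (2 *: qmap A x (row i (frame x))) (2 *: qmap A x (row i (frame x)))
  = 2 * m.+1%:R - 2 * dotv a (f x).
Proof.
move=> hx.
have h i : dotv (2 *: qmap A x (row i (frame x))) (2 *: qmap A x (row i (frame x)))
    = 2 - 2 * dotv (qmap A (row i (frame x)) (row i (frame x))) (f x).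
  rewrite dotvZl dotvZr fE// (dotvC _ (qmap A x x)).
  have := qmap_polar hx (frame_tangent hx i) (frame_unit hx i); lra.
rewrite (eq_bigr _ (fun i _ => h i)) sumrB sumr_const card_ord -mulr_sumr -dotv_suml.
rewrite (frame_trace_qmap A hx) -fE// dotvDl dotvNl f1// -natr1 -mulr_natr; ring.
Qed.

(** The gradient of rho is twice the tangential part of x B, whose norm Parseval gives. *)
Lemma gradient_norm x : dotv x x = 1 ->
  \sum_i dotv a (2 *: qmap A x (row i (frame x))) ^+ 2
  = 4 * (dotv (x *m B) (x *m B) - bil B x x ^+ 2).
Proof.
move=> hx; rewrite bil_dotv expr2 -(frame_parseval hx) mulr_sumr.
by apply: eq_bigr => i _; rewrite dotvZr -bil_lincomb -/B bil_dotv; ring.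
Qed.

Lemma biharmonic_scalar x : dotv x x = 1 -> bitension f x = 0 ->
  4 * (dotv (x *m B) (x *m B) - bil B x x ^+ 2)
  = (m.+1%:R - 2 * bil B x x) * (dotv a a - bil B x x ^+ 2).
Proof.
move=> hx h0; have := dotv_bitension sA fE f1 hx; cbv zeta.
rewrite h0 dotv0 energy_density// gradient_norm// fE// -bil_lincomb -/B.
lra.
Qed.

End ScalarEquation.

(** * The scalar equation forces a symmetric matrix to be scalar *)

Lemma cube_zero (R : realType) (c d : R) :
  c ^+ 3 - 3 * c * d ^+ 2 = 0 -> 3 * c ^+ 2 * d - d ^+ 3 = 0 -> c = 0 /\ d = 0.
Proof.
move=> h1 h2.
(* This is |z|^6 = |z^3|^2 for z = c + i d; the hypotheses say that the real and imaginary parts of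
   z^3 vanish. *)
have : (c ^+ 2 + d ^+ 2) ^+ 3 =
    (c ^+ 3 - 3 * c * d ^+ 2) ^+ 2 + (3 * c ^+ 2 * d - d ^+ 3) ^+ 2 by ring.
rewrite h1 h2 expr0n /= addr0 => /eqP; rewrite expf_eq0 /=.
by rewrite paddr_eq0 ?sqr_ge0// !sqrf_eq0 => /andP[/eqP -> /eqP ->].
Qed.

(* At [s = i] the identity becomes [rho ^ 3 = 0] for [rho = r - p + 2 q i]; the
   numbers in the proof are the Lagrange weights that evaluate a polynomial of
   degree 6 at [i] from its values at -3, .., 3. *)
Lemma sextic_identity (R : realType) (p q r al be ga M c : R) :
  (forall s : R, let N := s ^+ 2 + 1 in
     let rho := p * s ^+ 2 + 2 * q * s + r in
     let b := al * s ^+ 2 + 2 * be * s + ga in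
     4 * (b * N ^+ 2 - rho ^+ 2 * N)
     = (M * N - 2 * rho) * (c * N ^+ 2 - rho ^+ 2)) ->
  p = r /\ q = 0.
Proof.
move=> h; pose F (s : R) := let N := s ^+ 2 + 1 in
  let rho := p * s ^+ 2 + 2 * q * s + r in
  let b := al * s ^+ 2 + 2 * be * s + ga in
  4 * (b * N ^+ 2 - rho ^+ 2 * N) - (M * N - 2 * rho) * (c * N ^+ 2 - rho ^+ 2).
have F0 s : F s = 0 by apply/eqP; rewrite subr_eq0; apply/eqP/h.
have [||h1 h2] := @cube_zero _ (r - p) (2 * q).
- have -> : (r - p) ^+ 3 - 3 * (r - p) * (2 * q) ^+ 2 =
    - (25 / 9 * F 0 - 25 / 24 * (F 1 + F (- 1)) + 1 / 6 * (F 2 + F (- 2))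
       - 1 / 72 * (F 3 + F (- 3))) / 2 by rewrite /F; field.
  rewrite !F0; ring.
- have -> : 3 * (r - p) ^+ 2 * (2 * q) - (2 * q) ^+ 3 =
    - (25 / 24 * (F 1 - F (- 1)) - 1 / 3 * (F 2 - F (- 2))
       + 1 / 24 * (F 3 - F (- 3))) / 2 by rewrite /F; field.
  rewrite !F0; ring.
by split; lra.
Qed.

Lemma delta_bil (R : realType) k (B : 'M[R]_k) i j :
  bil B (delta_mx 0 i) (delta_mx 0 j) = B i j.
Proof. by rewrite /bil -rowE trmx_delta -colE !mxE. Qed.

(** It suffices to treat each coordinate plane, where the identity becomes one in a single real
    variable. *)
Lemma scalar_of_identity (R : realType) k (B : 'M[R]_k.+1) (M c : R) :
  B^T = B ->
  (forall x, dotv x x = 1 ->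
     4 * (dotv (x *m B) (x *m B) - bil B x x ^+ 2)
     = (M - 2 * bil B x x) * (c - bil B x x ^+ 2)) ->
  B = (B 0 0)%:M.
Proof.
move=> sB h.
(* Powers of |x|^2 bring every term to degree 6, which extends the identity from the sphere to all
   [x]. *)
have hom x : 4 * (dotv (x *m B) (x *m B) * dotv x x ^+ 2 - bil B x x ^+ 2 * dotv x x)
    = (M * dotv x x - 2 * bil B x x) * (c * dotv x x ^+ 2 - bil B x x ^+ 2).
  have [->|/unit_scale[s s0 [y hy ->]]] := eqVneq x 0.
    by rewrite !bil_dotv !dotv0; ring.
  rewrite -scalemxAl bilZl bilZr !dotvZl !dotvZr hy.
  transitivity (s ^+ 6 * (4 * (dotv (y *m B) (y *m B) - bil B y y ^+ 2))); first by ring.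
  rewrite h//; ring.
have key i j : i != j -> B i i = B j j /\ B i j = 0.
  move=> ij; pose e t : 'rV[R]_k.+1 := delta_mx 0 t.
  have ee s t : dotv (e s) (e t) = (s == t)%:R.
    by rewrite dotvE trmx_delta mul_delta_mx_cond; case: eqP => _; rewrite ?mulr1n !mxE.
  have Bee s t : bil B (e s) (e t) = B s t by exact: delta_bil.
  have sBe s t : B s t = B t s by rewrite -{1}sB mxE.
  (* Here x = s e_i + e_j, so |x|^2 = s^2 + 1, while rho and |x B|^2 are quadratic in [s]. *)
  apply: (@sextic_identity _ _ _ _ (dotv (e i *m B) (e i *m B))
     (dotv (e i *m B) (e j *m B)) (dotv (e j *m B) (e j *m B)) M c) => s /=.
  have := hom (s *: e i + e j).
  rewrite mulmxDl -scalemxAl !(bilDl, bilDr, bilZl, bilZr, dotvDl, dotvDr, dotvZl, dotvZr).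
  rewrite !Bee !ee !eqxx (negbTE ij) eq_sym (negbTE ij) (sBe j i) mulr1n mulr0n.
  rewrite (dotvC (e j *m B) (e i *m B)) => hs.
  lra.
apply/matrixP => i j; rewrite mxE.
have [<-|ij] := eqVneq i j; last by case: (key i j ij).
by have [->|i0] := eqVneq i 0; rewrite ?mulr1n//; case: (key i 0 i0).
Qed.

(** * Smoothness of linear combinations of smooth functions *)

Section Smoothness.
Variables (R : realType) (k : nat).
Implicit Types f g : 'rV[R]_k.+1 -> R.

Lemma Ck_cst d (c : R) : Ck d (fun _ : 'rV[R]_k.+1 => c).
Proof.
elim: d c => [|d IH] c /=; first by move=> x; exact: cst_continuous.
split=> [x|v]; first exact: differentiable_cst.
have -> : 'D_v (fun _ : 'rV[R]_k.+1 => c) = fun=> 0; last exact: IH.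
by apply/funext => x; rewrite derive_cst.
Qed.

Lemma CkD d f g : Ck d f -> Ck d g -> Ck d (fun x => f x + g x).
Proof.
elim: d f g => [|d IH] f g /=.
  by move=> cf cg x; exact: (continuousD (cf x) (cg x)).
move=> [df hf] [dg hg]; split=> [x|v]; first exact: differentiableD.
have -> : 'D_v (fun x => f x + g x) = (fun x => 'D_v f x + 'D_v g x).
  by apply/funext => x; rewrite -deriveD//; exact: diff_derivable.
exact: IH.
Qed.

Lemma CkZ d c f : Ck d f -> Ck d (fun x => c * f x).
Proof.
elim: d f => [|d IH] f /=.
  by move=> cf x; exact: (continuousM (@cst_continuous _ _ c x) (cf x)).
move=> [df hf]; split=> [x|v]; first exact: (differentiableZ c (df x)).
have -> : 'D_v (fun x => c * f x) = (fun x => c * 'D_v f x).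
  by apply/funext => x; apply: (deriveZ c); exact: diff_derivable.
exact: IH.
Qed.

Lemma Ck_sum d n (F : 'I_n -> 'rV[R]_k.+1 -> R) :
  (forall i, Ck d (F i)) -> Ck d (fun x => \sum_i F i x).
Proof.
elim: n F => [|n IH] F h.
  have -> : (fun x => \sum_i F i x) = fun=> 0; last exact: Ck_cst.
  by apply/funext => x; rewrite big_ord0.
have -> : (fun x => \sum_i F i x) =
    (fun x => F ord0 x + \sum_i F (lift ord0 i) x).
  by apply/funext => x; rewrite big_ord_recl.
by apply: CkD => //; exact: IH.
Qed.

End Smoothness.

(** * Orthogonal changes of target coordinates and the resulting decomposition *)

Section FirstComponents.
Variables (R : realType) (n : nat).
Implicit Types (y : 'rV[R]_n.+1) (T : 'M[R]_n.+1).

Lemma dotv_first_components y :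
  dotv (first_components y) (first_components y) = dotv y y - y 0 ord_max ^+ 2.
Proof.
rewrite /dotv big_ord_recr /= -expr2 addrK.
by apply: eq_bigr => i _; rewrite !mxE.
Qed.

Lemma mulmx_tr_coord y T i : (y *m T^T) 0 i = dotv (row i T) y.
Proof. by rewrite mxE; apply: eq_bigr => j _; rewrite !mxE mulrC. Qed.

Lemma first_components_coord y T (j : 'I_n) :
  first_components (y *m T^T) 0 j = dotv (row (widen_ord (leqnSn n) j) T) y.
Proof. by rewrite mxE mulmx_tr_coord. Qed.

Lemma dotv_orthogonal y T : T *m T^T = 1%:M -> dotv (y *m T^T) (y *m T^T) = dotv y y.
Proof.
by move=> /mulmx1C TT; rewrite !dotvE trmx_mul trmxK -mulmxA (mulmxA _ T) TT mul1mx.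
Qed.

End FirstComponents.

(** Averaging a coefficient matrix with its transpose does not change its quadratic polynomial. *)
Lemma quadratic_form_sym (R : realType) m n (f : 'rV[R]_m.+1 -> 'rV[R]_n.+1) :
  quadratic_form f ->
  exists A : 'I_n.+1 -> 'M[R]_m.+1, (forall j, (A j)^T = A j) /\
    forall y, dotv y y = 1 -> f y = qmap A y y.
Proof.
case=> -[A hA] _ _; exists (fun j => 2^-1 *: (A j + (A j)^T)); split=> [j|y hy].
  by apply/matrixP => s t; rewrite !mxE addrC.
apply/rowP => j; rewrite hA; last exact/sphere1P.
rewrite mxE /bil -scalemxAr -scalemxAl mulmxDr mulmxDl -bilE.
have -> : y *m (A j)^T *m y^T = y *m A j *m y^T.
  rewrite [RHS]mx11_scalar -[RHS]tr_scalar_mx -mx11_scalar.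
  by rewrite !trmx_mul trmxK mulmxA.
by rewrite /bil; move: (y *m A j *m y^T) => P; rewrite !mxE; lra.
Qed.

Theorem theorem3p5 (R : realType) (m n : nat) (hm : (1 <= m)%N) (hn : (1 <= n)%N)
    (phi : 'rV[R]_m.+1 -> 'rV[R]_n.+1)
    (hquad : quadratic_form phi)
    (hbih : proper_biharmonic 1 phi) :
  exists T : 'M[R]_n.+1, T *m T^T = 1%:M /\
    harmonic_map (Num.sqrt 2)^-1
      (fun x : 'rV[R]_m.+1 => first_components (phi x *m T^T)).
Proof.
have [A [sA fE]] := quadratic_form_sym hquad.
have [_ hsph hnc] := hquad.
have f1 y : dotv y y = 1 -> dotv (phi y) (phi y) = 1.
  by move=> hy; apply/sphere1P/hsph/sphere1P.
have [[hsm hbi] hnh] := hbih.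
pose a := trace_vec A; pose B := lincomb a A.
have hB x (hx : dotv x x = 1) := biharmonic_scalar sA fE f1 hx (hbi x ((sphere1P x).2 hx)).
have Bsc := scalar_of_identity (lincomb_sym a sA) hB.
set lam := lincomb a A 0 0 in Bsc.
have bilB x : bil B x x = lam * dotv x x.
  by rewrite /B Bsc bil_dotv mul_mx_scalar dotvZl.
have rhoE x : dotv x x = 1 -> dotv a (phi x) = lam.
  by move=> hx; rewrite fE// -bil_lincomb -/B bilB hx mulr1.
(* Both sides are the trace of B = lam I. *)
have aa : dotv a a = lam * m.+1%:R.
  by rewrite -lincomb_trace Bsc mxtrace_scalar mulr_natr.
pose x0 : 'rV[R]_m.+1 := delta_mx 0 0.
have hx0 : dotv x0 x0 = 1 by rewrite dotvE trmx_delta mul_delta_mx mxE.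
(* For B = lam I and |x| = 1, |x B|^2 = lam^2 = rho^2, so the gradient side of the scalar equation
   vanishes. *)
have alt : (m.+1%:R - 2 * lam) * (dotv a a - lam ^+ 2) = 0.
  have := hB x0 hx0; rewrite -/B bilB hx0 mulr1 -/a => <-.
  rewrite /B Bsc mul_mx_scalar dotvZl dotvZr hx0; ring.
(* If a = 0 the tension vanishes and [phi] is harmonic. *)
have aa0 : dotv a a != 0.
  apply/negP; rewrite dotvv_eq0 => /eqP a0; apply: hnh; split=> // x /sphere1P hx.
  by rewrite (tension_quad sA fE)// -/a a0 scaler0 projT0.
have lam0 : lam != 0.
  by apply: contra_neq aa0 => l0; rewrite aa l0 mul0r.
(* Otherwise Cauchy-Schwarz is an equality for [a] and phi(x): |phi(x) - a / lam|^2 = 1 - 2 + 1 = 0,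
   and [phi] is constant. *)
have nconst : dotv a a - lam ^+ 2 != 0.
  apply/negP => /eqP e; apply: hnc; exists (lam^-1 *: a) => x /sphere1P hx.
  apply/eqP; rewrite -subr_eq0 -dotvv_eq0 dotvDl !dotvDr !dotvNl !dotvNr !dotvZl !dotvZr.
  rewrite f1// (dotvC _ a) rhoE// (_ : dotv a a = lam ^+ 2); last by lra.
  by apply/eqP; field.
have lamE : m.+1%:R = 2 * lam.
  by apply/eqP; rewrite -subr_eq0; move/eqP: alt; rewrite mulf_eq0 (negbTE nconst) orbF.
have s2 : Num.sqrt 2 ^+ 2 = 2 :> R by rewrite sqr_sqrtr.
have s20 : Num.sqrt 2 != 0 :> R by rewrite gt_eqF// sqrtr_gt0.
(* Now |a|^2 = (m + 1) lam = 2 lam^2, so [mu] normalises [a]. *)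
pose mu := (Num.sqrt 2 * lam)^-1.
have mu2 : mu ^+ 2 * dotv a a = 1.
  by rewrite /mu exprVn exprMn s2 aa lamE; field.
have mu0 : mu != 0 by rewrite invr_eq0 mulf_neq0.
have hmua : dotv (mu *: a) (mu *: a) = 1 by rewrite dotvZl dotvZr mulrA -expr2.
have [T [TT Tb]] := orthogonal_completion hmua.
exists T; split=> //.
(* These rows are orthogonal to the last one, [mu *: a], so the matrix of the j-th new component has
   trace <r_j, a> = 0. *)
pose r (j : 'I_n) := row (widen_ord (leqnSn n) j) T.
have ra j : dotv (r j) a = 0.
  apply: (mulfI mu0); rewrite mulr0 -dotvZr -Tb dotv_row TT mxE -val_eqE /=.
  by rewrite ltn_eqF.
have psiE x : dotv x x = 1 ->
    first_components (phi x *m T^T) = qmap (fun j => lincomb (r j) A) x x.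
  move=> hx; apply/rowP => j.
  by rewrite first_components_coord mxE bil_lincomb fE.
split; last first.
  move=> x /sphere1P hx; rewrite (tension_quad _ psiE)//.
    have -> : trace_vec (fun j => lincomb (r j) A) = 0; last by rewrite scaler0 projT0.
    by apply/rowP => j; rewrite !mxE lincomb_trace ra.
  by move=> j; exact: lincomb_sym.
(* The last coordinate of the rotated map is mu lam = 1 / sqrt 2, which leaves 1 - 1/2 for the
   squared norm of the others. *)
split=> [x /sphere1P hx|].
  apply/enorm_dotv; first by rewrite invr_ge0 sqrtr_ge0.
  rewrite dotv_first_components dotv_orthogonal// f1// mulmx_tr_coord Tb dotvZl rhoE//.
  have -> : mu * lam = (Num.sqrt 2)^-1 by rewrite /mu; field; apply/andP.
  by rewrite exprVn s2; lra.
(* A smooth ambient extension of [phi], rotated and truncated, extends the first components. *)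
have [_ [F [hF FE]]] := hsm.
exists (fun x => first_components (F x *m T^T)); split=> [d j|x hx]; last first.
  by rewrite FE.
have -> : (fun x => first_components (F x *m T^T) 0 j) =
    (fun x => \sum_i r j 0 i * F x 0 i).
  by apply/funext => x; rewrite first_components_coord.
by apply: Ck_sum => i; exact: CkZ.
Qed.
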